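(* Assume the set of atomic formulas (= atomic graphs) is non-empty. Then: (a) The schema $G''\supset(-G''\supset H'')$ is not valid in the semantics of GT4: there exist graphs $G,H$ of GET4 such that $G''\supset(-G''\supset H'')\notin VT4$. (b) The system of existential graphs GET4 is paraconsistent with respect to the negation $G\mapsto\{G\}$: there exist graphs $G,H$ such that it is not the case that $G\{G\}\gg H$ in GET4. (c) The deductive system GT4 is paraconsistent with respect to the negation $-$: there exist formulas $X,Y\in FT$ such that $Y$ is not a consequence of $\{X,-X\}$ in GT4.
   Context: Paraconsistency: a deductive system with negation operator $N$ is paraconsistent when it does not derive all its formulas from $X$ and $NX$. Formulas. $FA$ is a set of atomic formulas. $FT$ is the smallest set containing $FA$ and the constant $\lambda$, and closed under the unary connective $-$ (weak negation) and the binary connective $\supset$. Abbreviations: $\sim X:=X\supset-\lambda$; $+X:=\sim-X$; $\otimes X:=-\sim X$; $X\cup Y:=\sim X\supset Y$; $X\cap Y:=\sim(X\supset\sim Y)$. System GT. Axioms (for all $X,Y,Z\in FT$): Ax1 $\lambda$; Ax2 $X\supset(Y\supset X)$; Ax3 $[X\supset(Y\supset Z)]\supset[(X\supset Y)\supset(X\supset Z)]$; Ax4 $[(X\supset Y)\supset X]\supset X$; Ax5 $-\lambda\supset Z$; Ax6 $(X\supset-\lambda)\supset-X$; Ax7 $[-(X\supset Y)\supset-\lambda]\supset[(-X\supset-\lambda)\supset(-Y\supset-\lambda)]$; Ax+: if $X$ is an instance of one of Ax1,…,Ax7, then $-X\supset-\lambda$ is an axiom. The only rule is modus ponens Mp.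 GT4 is GT with the added axiom schema $+X\supset[-(+X\cap Y)\supset-Y]$. $Y$ is a consequence of a set of formulas in GT4 if $Y$ is derivable by Mp from the axioms of GT4 together with the formulas of the set as assumptions. Models. A model for GT4 is $(S,Ma,<,V)$ where $S$ is a non-empty set, $Ma\in S$ is the actual world, $<$ is a reflexive and transitive binary relation on $S$, and $V:S\times FT\to\{0,1\}$, written $M(X)=V(M,X)$, satisfies for all $M\in S$: $M(\lambda)=1$; $M(X\supset Y)=1$ iff ($M(X)=1$ implies $M(Y)=1$); $M(-X)=1$ iff there is $P\in S$ with $M<P$ and $P(X)=0$. $X\in VT4$ means $Ma(X)=1$ in every such model. Graphs. $GA=FA$ is the set of atomic graphs. Graphs are built from atomic graphs and the blank sheet of assertion $\lambda$ by juxtaposition $XY$ (in the same region), continuous cut $(X)$, and broken cut $\{X\}$. As $\lambda$ is blank, it may be inserted or deleted anywhere. $*X:=(\{X\})$. A region is even (odd) if it is surrounded by an even (odd) number of cuts, continuous or broken. Transformation rules of GET (applied to parts of a graph located in the indicated region). R1: $(\{\lambda\})$ may be written on the sheet of assertion. R2: in an even region, $XY\Rightarrow X$; in an odd region, $X\Rightarrow XY$. R3: $Y(X)\Leftrightarrow Y(XY)$ in a region surrounded only by (zero or more) continuous cuts; $X\Leftrightarrow XX$; $*Y(X)\Leftrightarrow *Y(X*Y)$ in a region surrounded by at least one broken cut. Here R3 allows iteration and de-iteration in any such region, even or odd. R4: in an even region, $(X)\Rightarrow\{X\}$; in an odd region, $\{X\}\Rightarrow(X)$. R6: in an even region, $((X))\Rightarrow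 X$; in an odd region, $X\Rightarrow((X))$. R7: two graphs in the same region may be juxtaposed, and juxtaposed graphs may be separated. R8: $XY\Leftrightarrow YX$ in any region. R9: juxtaposition is associative in any region. GET4 is GET with the added rule strong I-D: a strong graph $*Y$ may be iterated into, and de-iterated from, a region nested inside cuts at least one of which is broken, i.e. $*Y[X]\Leftrightarrow *Y[*Y\,X]$, where $[\,\cdot\,]$ denotes such a nested region, even or odd (in particular $*Y\{X\}\Leftrightarrow *Y\{*Y\,X\}$). $X\gg Y$ in GET4 means $Y$ is obtained from $X$ by finitely many applications of these rules. Translation: $P''=P$ for $P\in GA$; $\lambda''=\lambda$; $(X(Y))''=X''\supset Y''$; $((X)(Y))''=X''\cup Y''$; $\{X\}''=-X''$; $(XY)''=X''\cap Y''$ (juxtaposition); and $(X)''=\sim X''$ for a single continuous cut. *)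

(* Defs.v *)
From Stdlib Require Import Arith.

Set Implicit Arguments.
Unset Strict Implicit.

Declare Scope gt_scope.
Delimit Scope gt_scope with gt.
Open Scope gt_scope.

(** * Formulas *)

Inductive formula (FA : Type) : Type :=
| Atom : FA -> formula FA
| Lam : formula FA
| Neg : formula FA -> formula FA
| Imp : formula FA -> formula FA -> formula FA.

Arguments Lam {FA}.

Notation "X --> Y" := (Imp X Y) (at level 55, right associativity) : gt_scope.

Section Abbreviations.
Variable FA : Type.
Implicit Types X Y : formula FA.

(* [NegC] is the classical negation ~X, [Strong] is +X. *)
Definition NegC X := X --> Neg Lam.
Definition Strong X := NegC (Neg X).
Definition Or X Y := NegC X --> Y.
Definition And X Y := NegC (X --> NegC Y).
End Abbreviations.

(** * The deductive system GT4 *)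

Inductive GT_base_axiom (FA : Type) : formula FA -> Prop :=
| Ax1 : GT_base_axiom Lam
| Ax2 X Y : GT_base_axiom (X --> (Y --> X))
| Ax3 X Y Z :
    GT_base_axiom ((X --> (Y --> Z)) --> ((X --> Y) --> (X --> Z)))
| Ax4 X Y : GT_base_axiom (((X --> Y) --> X) --> X)
| Ax5 Z : GT_base_axiom (Neg Lam --> Z)
| Ax6 X : GT_base_axiom ((X --> Neg Lam) --> Neg X)
| Ax7 X Y :
    GT_base_axiom ((Neg (X --> Y) --> Neg Lam) -->
                   ((Neg X --> Neg Lam) --> (Neg Y --> Neg Lam))).

Inductive GT_axiom (FA : Type) : formula FA -> Prop :=
| GT_base X : GT_base_axiom X -> GT_axiom X
| GT_plus X : GT_base_axiom X -> GT_axiom (Neg X --> Neg Lam).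

Inductive GT4_axiom (FA : Type) : formula FA -> Prop :=
| GT4_GT X : GT_axiom X -> GT4_axiom X
| GT4_four X Y :
    GT4_axiom (Strong X --> (Neg (And (Strong X) Y) --> Neg Y)).

Inductive GT4_consequence (FA : Type) (Gamma : formula FA -> Prop) :
    formula FA -> Prop :=
| GT4_assumption X : Gamma X -> GT4_consequence Gamma X
| GT4_ax X : GT4_axiom X -> GT4_consequence Gamma X
| GT4_mp X Y :
    GT4_consequence Gamma X -> GT4_consequence Gamma (X --> Y) ->
    GT4_consequence Gamma Y.

(** * Semantics *)

(* Non-emptiness of the set of worlds is witnessed by [actual]. *)
Record GT4_model (FA : Type) := {
  world : Type;
  actual : world;
  acc : world -> world -> Prop;
  val : world -> formula FA -> bool;
  acc_refl : forall M, acc M M;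
  acc_trans : forall M N P, acc M N -> acc N P -> acc M P;
  val_Lam : forall M, val M Lam = true;
  val_Imp : forall M X Y,
    val M (X --> Y) = true <-> (val M X = true -> val M Y = true);
  val_Neg : forall M X,
    val M (Neg X) = true <-> exists P, acc M P /\ val P X = false
}.

Definition VT4 (FA : Type) (X : formula FA) : Prop :=
  forall m : GT4_model FA, val (actual m) X = true.

(** * Existential graphs *)

(* Graphs are syntax trees: commutativity and associativity of juxtaposition
   and neutrality of the blank are transformation rules, not identities.
   [Cut X] is (X) and [BCut X] is {X}. *)
Inductive graph (FA : Type) : Type :=
| GAtom : FA -> graph FA
| Blank : graph FA
| Juxt : graph FA -> graph FA -> graph FA
| Cut : graph FA -> graph FA
| BCut : graph FA -> graph FA.

Arguments Blank {FA}.

Notation "X ** Y" := (Juxt X Y) (at level 40, left associativity) : gt_scope.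

Definition star (FA : Type) (X : graph FA) : graph FA := Cut (BCut X).

(* A region of a graph is the position of the hole of a one-hole context. *)
Inductive context (FA : Type) : Type :=
| Hole : context FA
| CJuxtL : context FA -> graph FA -> context FA
| CJuxtR : graph FA -> context FA -> context FA
| CCut : context FA -> context FA
| CBCut : context FA -> context FA.

Section Regions.
Variable FA : Type.
Implicit Types C : context FA.

Fixpoint fill C (X : graph FA) : graph FA :=
  match C with
  | Hole _ => X
  | CJuxtL C' Z => fill C' X ** Z
  | CJuxtR Z C' => Z ** fill C' X
  | CCut C' => Cut (fill C' X)
  | CBCut C' => BCut (fill C' X)
  end.

Fixpoint cuts C : nat :=
  match C with
  | Hole _ => 0
  | CJuxtL C' _ | CJuxtR _ C' => cuts C'
  | CCut C' | CBCut C' => S (cuts C')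
  end.

Fixpoint broken_cuts C : nat :=
  match C with
  | Hole _ => 0
  | CJuxtL C' _ | CJuxtR _ C' | CCut C' => broken_cuts C'
  | CBCut C' => S (broken_cuts C')
  end.

Definition even_region C : Prop := Nat.Even (cuts C).
Definition odd_region C : Prop := Nat.Odd (cuts C).
End Regions.

(** * The transformation system GET4 *)

(* In both relations the context is the region in which the rewritten part
   lies. *)
Inductive one_way_rule (FA : Type) (C : context FA) :
    graph FA -> graph FA -> Prop :=
| R1 X : cuts C = 0 -> one_way_rule C X (X ** Cut (BCut Blank))
| R2_even X Y : even_region C -> one_way_rule C (X ** Y) X
| R2_odd X Y : odd_region C -> one_way_rule C X (X ** Y)
| R4_even X : even_region C -> one_way_rule C (Cut X) (BCut X)
| R4_odd X : odd_region C -> one_way_rule C (BCut X) (Cut X)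
| R6_even X : even_region C -> one_way_rule C (Cut (Cut X)) X
| R6_odd X : odd_region C -> one_way_rule C X (Cut (Cut X)).

(* In [strong_ID] the nested region is the hole of [D], so the broken cut has
   to lie between the outer occurrence of [star Y] and the inner one. *)
Inductive two_way_rule (FA : Type) (C : context FA) :
    graph FA -> graph FA -> Prop :=
| blank X : two_way_rule C X (X ** Blank)
| R3_cut X Y :
    broken_cuts C = 0 -> two_way_rule C (Y ** Cut X) (Y ** Cut (X ** Y))
| R3_copy X : two_way_rule C X (X ** X)
| R3_strong X Y :
    0 < broken_cuts C ->
    two_way_rule C (star Y ** Cut X) (star Y ** Cut (X ** star Y))
| R8 X Y : two_way_rule C (X ** Y) (Y ** X)
| R9 X Y Z : two_way_rule C ((X ** Y) ** Z) (X ** (Y ** Z))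
| strong_ID X Y (D : context FA) :
    0 < broken_cuts D ->
    two_way_rule C (star Y ** fill D X) (star Y ** fill D (star Y ** X)).

Inductive GET4_step (FA : Type) : graph FA -> graph FA -> Prop :=
| step_one_way C X Y :
    one_way_rule C X Y -> GET4_step (fill C X) (fill C Y)
| step_forth C X Y :
    two_way_rule C X Y -> GET4_step (fill C X) (fill C Y)
| step_back C X Y :
    two_way_rule C X Y -> GET4_step (fill C Y) (fill C X).

(* R7 acts on graphs standing separately on the sheet of assertion; inside a
   cut, graphs in the same region are already joined by [Juxt]. *)
Inductive GET4_derives (FA : Type) (X : graph FA) : graph FA -> Prop :=
| derives_refl : GET4_derives X X
| derives_step Y Z : GET4_derives X Y -> GET4_step Y Z -> GET4_derives X Z
| R7_join Y Z :
    GET4_derives X Y -> GET4_derives X Z -> GET4_derives X (Y ** Z)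
| R7_left Y Z : GET4_derives X (Y ** Z) -> GET4_derives X Y
| R7_right Y Z : GET4_derives X (Y ** Z) -> GET4_derives X Z.

Notation "X >> Y" := (GET4_derives X Y) (at level 70, no associativity) :
  gt_scope.

(** * Translation of graphs into formulas *)

(* The clauses for ((X)(Y)), (X(Y)) and (X) overlap; the most specific one
   takes precedence. *)
Fixpoint translate (FA : Type) (G : graph FA) : formula FA :=
  match G with
  | GAtom p => Atom p
  | Blank => Lam
  | Cut (Cut X ** Cut Y) => Or (translate X) (translate Y)
  | Cut (X ** Cut Y) => translate X --> translate Y
  | Cut X => NegC (translate X)
  | BCut X => Neg (translate X)
  | X ** Y => And (translate X) (translate Y)
  end.

(* Main.v *)
Require Import Defs.
From Stdlib Require Import Arith Bool.

(** A single countermodel refutes all three explosions.  Take two worlds, the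
    actual one seeing itself and a second one, the second one seeing only
    itself, and let the atom [p] be true at the actual world alone.  At the
    actual world both [p] and its weak negation hold, the latter because of the
    second world, whereas [Neg Lam] is false at every world of every model, and
    so is the translation of the cut around the blank sheet.  This is (a).

    For (b) and (c) it remains to see that derivations preserve truth at the
    actual world of any model.  On the deductive side ([GT4_sound]) every axiom
    is true at every world, and modus ponens acts within one world.
    On the graphical side ([GET4_sound]) a broken cut, like a continuous one,
    reverses entailments that hold at all worlds, so that one-way rules are
    governed by the parity of the region ([fill_monotone]).  Two-way rules
    replace a graph by one with the same truth value; since the truth value at
    [w] depends only on the worlds accessible from [w], it is enough to have
    the same value at those ([fill_congr]).  For the strong rules, [star Y] at
    [w] says that [Y] holds at all worlds accessible from [w], and by
    transitivity this persists at these worlds, hence inside broken cuts. *)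

(** * Truth at a world *)

Section Truth.
Variables (FA : Type) (m : GT4_model FA).
Implicit Types (w P : world m) (X Y : formula FA).

Lemma val_Imp_implb w X Y : val w (X --> Y) = implb (val w X) (val w Y).
Proof.
  apply eq_true_iff_eq. rewrite val_Imp.
  destruct (val w X), (val w Y); simpl; intuition congruence.
Qed.

Lemma val_Neg_Lam w : val w (Neg Lam) = false.
Proof.
  apply not_true_iff_false. rewrite val_Neg.
  intros (P & _ & HP). rewrite val_Lam in HP. discriminate.
Qed.

Lemma val_NegC w X : val w (NegC X) = negb (val w X).
Proof.
  unfold NegC. rewrite val_Imp_implb, val_Neg_Lam.
  now destruct (val w X).
Qed.

Lemma val_Or w X Y : val w (Or X Y) = val w X || val w Y.
Proof.
  unfold Or. rewrite val_Imp_implb, val_NegC.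
  now destruct (val w X).
Qed.

Lemma val_And w X Y : val w (And X Y) = val w X && val w Y.
Proof.
  unfold And. rewrite val_NegC, val_Imp_implb, val_NegC.
  now destruct (val w X), (val w Y).
Qed.

Lemma val_Neg_false w X :
  val w (Neg X) = false <-> forall P, acc w P -> val P X = true.
Proof.
  rewrite <- not_true_iff_false, val_Neg. split.
  - intros H P HwP. apply not_false_iff_true. intros HP. apply H. now exists P.
  - intros H (P & HwP & HP). rewrite (H P HwP) in HP. discriminate.
Qed.

Lemma val_Strong w X :
  val w (Strong X) = true <-> forall P, acc w P -> val P X = true.
Proof.
  unfold Strong. rewrite val_NegC, negb_true_iff. apply val_Neg_false.
Qed.

(** This is what the axiom schema of GT4 expresses, and the only reason why a
    strong graph can be copied across broken cuts. *)
Lemma val_Strong_persistent w P X :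
  acc w P -> val w (Strong X) = true -> val P (Strong X) = true.
Proof.
  rewrite !val_Strong. intros HwP H Q HPQ.
  apply H. now apply acc_trans with P.
Qed.

Lemma val_Neg_congr w X Y :
  (forall P, acc w P -> val P X = val P Y) -> val w (Neg X) = val w (Neg Y).
Proof.
  intros H. apply eq_true_iff_eq. rewrite !val_Neg.
  split; intros (P & HwP & HP); exists P; split; trivial;
    [rewrite <- H | rewrite H]; trivial.
Qed.

Lemma val_Neg_antitone X Y :
  (forall P, val P X = true -> val P Y = true) ->
  forall w, val w (Neg Y) = true -> val w (Neg X) = true.
Proof.
  intros H w. rewrite !val_Neg. intros (P & HwP & HP). exists P. split; trivial.
  apply not_true_iff_false. intros HX. rewrite (H P HX) in HP. discriminate.
Qed.

(** * Soundness of the deductive system *)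

Lemma GT_base_axiom_valid X : GT_base_axiom X -> forall w, val w X = true.
Proof.
  intros H w. destruct H as [| X Y | X Y Z | X Y | Z | X | X Y].
  - apply val_Lam.
  - rewrite !val_Imp_implb. now destruct (val w X), (val w Y).
  - rewrite !val_Imp_implb. now destruct (val w X), (val w Y), (val w Z).
  - rewrite !val_Imp_implb. now destruct (val w X), (val w Y).
  - now rewrite val_Imp_implb, val_Neg_Lam.
  - fold (NegC X). apply val_Imp. rewrite val_NegC, negb_true_iff, val_Neg.
    intros HX. exists w. split; [apply acc_refl | trivial].
  - (* Read through [Strong], this is the distribution of necessity. *)
    change (val w (Strong (X --> Y) --> Strong X --> Strong Y) = true).
    rewrite !val_Imp, !val_Strong. intros HXY HX P HwP.
    exact (proj1 (val_Imp P X Y) (HXY P HwP) (HX P HwP)).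
Qed.

Lemma GT4_axiom_valid X : GT4_axiom X -> forall w, val w X = true.
Proof.
  intros [X' [Z HZ | Z HZ] | X' Y] w.
  - now apply GT_base_axiom_valid.
  - change (val w (Strong Z) = true). rewrite val_Strong.
    intros P _. now apply GT_base_axiom_valid.
  - rewrite !val_Imp, !val_Neg. intros HX (P & HwP & HP).
    exists P. split; trivial.
    rewrite val_And, (val_Strong_persistent w P X' HwP HX) in HP. exact HP.
Qed.

Lemma GT4_sound (Gamma : formula FA -> Prop) Y :
  (forall X, Gamma X -> val (actual m) X = true) ->
  GT4_consequence Gamma Y -> val (actual m) Y = true.
Proof.
  intros HGamma H. induction H as [X HX | X HX | X Y _ IHX _ IHXY].
  - now apply HGamma.
  - now apply GT4_axiom_valid.
  - rewrite val_Imp in IHXY. now apply IHXY.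
Qed.

(** * Truth of graphs *)

Implicit Types (G : graph FA) (C : context FA).

Lemma val_Juxt w (G H : graph FA) :
  val w (translate (G ** H)) = val w (translate G) && val w (translate H).
Proof. apply val_And. Qed.

(** The special clauses of the translation for cuts enclosing other cuts only
    abbreviate: up to equivalence, a continuous cut is always classical
    negation.  The claim for [A ** Cut B] uses those for [B] and, when [A] is
    itself a cut, for the graph inside it; these are not immediate subgraphs, so
    structural induction on immediate subgraphs is too weak. *)
Lemma val_Cut : forall G w,
  val w (translate (Cut G)) = negb (val w (translate G)).
Proof.
  fix IH 1. intros G w.
  destruct G as [p | | A B | A | A]; try apply val_NegC.
  destruct B as [p | | B1 B2 | B | B]; try (destruct A; apply val_NegC).
  rewrite val_Juxt, (IH B w).
  destruct A as [p | | A1 A2 | A | A].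
  4: { rewrite (IH A w), negb_andb, !negb_involutive. apply val_Or. }
  all: rewrite negb_andb, negb_involutive, <- implb_orb; apply val_Imp_implb.
Qed.

Lemma val_star w G : val w (translate (star G)) = val w (Strong (translate G)).
Proof. unfold star. rewrite val_Cut. symmetry. apply val_NegC. Qed.

(** Transitivity of [acc] carries the hypothesis into broken cuts of [C]. *)
Lemma fill_congr C G H : forall w,
  (forall P, acc w P -> val P (translate G) = val P (translate H)) ->
  val w (translate (fill C G)) = val w (translate (fill C H)).
Proof.
  induction C as [| C IH Z | Z C IH | C IH | C IH]; intros w Hw; cbn [fill].
  - apply Hw, acc_refl.
  - rewrite !val_Juxt. now rewrite (IH w Hw).
  - rewrite !val_Juxt. now rewrite (IH w Hw).
  - rewrite !val_Cut. now rewrite (IH w Hw).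
  - apply val_Neg_congr. intros P HwP. apply IH.
    intros Q HPQ. apply Hw. now apply acc_trans with P.
Qed.

Definition entails (G H : graph FA) : Prop :=
  forall w, val w (translate G) = true -> val w (translate H) = true.

Lemma entails_Cut G H : entails G H -> entails (Cut H) (Cut G).
Proof.
  intros HGH w. rewrite !val_Cut, !negb_true_iff, <- !not_true_iff_false.
  intros HH HG. now apply HH, HGH.
Qed.

(** Each cut swaps the two halves of the statement, so they are proved
    together. *)
Lemma fill_monotone C G H :
  entails G H ->
  (even_region C -> entails (fill C G) (fill C H)) /\
  (odd_region C -> entails (fill C H) (fill C G)).
Proof.
  intros HGH. unfold even_region, odd_region.
  induction C as [| C IH Z | Z C IH | C IH | C IH];
    cbn [fill cuts].
  - split; [trivial | intros [k Hk]; now destruct k].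
  - destruct IH as [IHe IHo]. split; intros HC w; rewrite !val_Juxt, !andb_true_iff;
      intros [HG HZ]; split; trivial; [apply IHe | apply IHo]; trivial.
  - destruct IH as [IHe IHo]. split; intros HC w; rewrite !val_Juxt, !andb_true_iff;
      intros [HZ HG]; split; trivial; [apply IHe | apply IHo]; trivial.
  - destruct IH as [IHe IHo].
    rewrite Nat.Even_succ, Nat.Odd_succ. split; intros HC; apply entails_Cut; auto.
  - destruct IH as [IHe IHo].
    rewrite Nat.Even_succ, Nat.Odd_succ.
    split; intros HC; unfold entails; apply val_Neg_antitone;
      [apply IHo | apply IHe]; trivial.
Qed.

Lemma fill_monotone_even C G H :
  even_region C -> entails G H -> entails (fill C G) (fill C H).
Proof. intros HC HGH. exact (proj1 (fill_monotone C G H HGH) HC). Qed.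

Lemma fill_monotone_odd C G H :
  odd_region C -> entails H G -> entails (fill C G) (fill C H).
Proof. intros HC HHG. exact (proj2 (fill_monotone C H G HHG) HC). Qed.

(** * Soundness of the transformation rules *)

Lemma one_way_rule_sound C G H :
  one_way_rule C G H -> entails (fill C G) (fill C H).
Proof.
  intros [X HC | X Y HC | X Y HC | X HC | X HC | X HC | X HC];
    [ apply fill_monotone_even | apply fill_monotone_even | apply fill_monotone_odd
    | apply fill_monotone_even | apply fill_monotone_odd
    | apply fill_monotone_even | apply fill_monotone_odd ]; trivial.
  - exists 0. exact HC.
  - intros w HX. fold (star (@Blank FA)).
    rewrite val_Juxt, HX, val_star. apply val_Strong. intros P _. apply val_Lam.
  - intros w. rewrite val_Juxt, andb_true_iff. tauto.
  - intros w. rewrite val_Juxt, andb_true_iff. tauto.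
  - intros w. rewrite val_Cut, negb_true_iff. intros HX.
    apply val_Neg. exists w. split; [apply acc_refl | trivial].
  - intros w. rewrite val_Cut, negb_true_iff. intros HX.
    apply val_Neg. exists w. split; [apply acc_refl | trivial].
  - intros w. now rewrite !val_Cut, negb_involutive.
  - intros w. now rewrite !val_Cut, negb_involutive.
Qed.

Lemma strong_ID_sound D G H w :
  val w (translate (star H ** fill D G)) =
  val w (translate (star H ** fill D (star H ** G))).
Proof.
  rewrite !val_Juxt.
  destruct (val w (translate (star H))) eqn:HH; simpl; trivial.
  rewrite val_star in HH.
  apply fill_congr. intros P HwP.
  now rewrite val_Juxt, val_star, (val_Strong_persistent w P _ HwP HH).
Qed.

Lemma two_way_rule_sound C G H w :
  two_way_rule C G H ->
  val w (translate (fill C G)) = val w (translate (fill C H)).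
Proof.
  intros HGH. apply fill_congr. intros P _.
  destruct HGH as [X | X Y _ | X | X Y _ | X Y | X Y Z | X Y D _].
  - rewrite val_Juxt. simpl (translate Blank). now rewrite val_Lam, andb_true_r.
  - rewrite !val_Juxt, !val_Cut, val_Juxt.
    now destruct (val P (translate X)), (val P (translate Y)).
  - now rewrite val_Juxt, andb_diag.
  - rewrite !val_Juxt, !val_Cut, val_Juxt.
    now destruct (val P (translate X)), (val P (translate (star Y))).
  - rewrite !val_Juxt. apply andb_comm.
  - rewrite !val_Juxt. symmetry. apply andb_assoc.
  - apply strong_ID_sound.
Qed.

Lemma GET4_step_sound G H : GET4_step G H -> entails G H.
Proof.
  intros [C X Y HXY | C X Y HXY | C X Y HXY].
  - now apply one_way_rule_sound.
  - intros w. now rewrite (two_way_rule_sound C X Y w HXY).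
  - intros w. now rewrite (two_way_rule_sound C X Y w HXY).
Qed.

Lemma GET4_sound G H : G >> H -> entails G H.
Proof.
  intros HGH w HG.
  induction HGH as [| Y Z _ IH HYZ | Y Z _ IHY _ IHZ | Y Z _ IH | Y Z _ IH].
  - trivial.
  - now apply (GET4_step_sound Y Z).
  - now rewrite val_Juxt, IHY, IHZ.
  - rewrite val_Juxt, andb_true_iff in IH. apply IH.
  - rewrite val_Juxt, andb_true_iff in IH. apply IH.
Qed.

End Truth.

(** * The two-world countermodel *)

Section TwoWorlds.
Variable FA : Type.

(** World [true] is the actual one and sees both worlds; [false] sees only
    itself. *)
Definition two_acc (w P : bool) : Prop := w = true \/ P = false.

Fixpoint two_val (w : bool) (X : formula FA) : bool :=
  match X with
  | Atom _ => w
  | Lam => true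
  | Neg X => negb (two_val w X && two_val false X)
  | X --> Y => implb (two_val w X) (two_val w Y)
  end.

Lemma two_acc_refl w : two_acc w w.
Proof. destruct w; unfold two_acc; auto. Qed.

Lemma two_acc_trans w P Q : two_acc w P -> two_acc P Q -> two_acc w Q.
Proof. unfold two_acc. intuition congruence. Qed.

Lemma two_val_Imp w X Y :
  two_val w (X --> Y) = true <-> (two_val w X = true -> two_val w Y = true).
Proof.
  simpl. destruct (two_val w X), (two_val w Y); simpl; intuition congruence.
Qed.

Lemma two_val_Neg w X :
  two_val w (Neg X) = true <-> exists P, two_acc w P /\ two_val P X = false.
Proof.
  simpl. rewrite negb_true_iff, andb_false_iff. split.
  - intros [H | H]; [exists w | exists false]; split; trivial.
    + apply two_acc_refl.
    + now right.
  - intros (P & HwP & HP). destruct w, P, HwP; try discriminate; auto.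
Qed.

Definition two_worlds : GT4_model FA :=
  {| world := bool;
     actual := true;
     acc := two_acc;
     val := two_val;
     acc_refl := two_acc_refl;
     acc_trans := two_acc_trans;
     val_Lam := fun _ => eq_refl;
     val_Imp := two_val_Imp;
     val_Neg := two_val_Neg |}.
End TwoWorlds.

Theorem mainTheorem5 (FA : Type) (FA_nonempty : inhabited FA) :
  (exists G H : graph FA,
     ~ VT4 (translate G --> (Neg (translate G) --> translate H))) /\
  (exists G H : graph FA, ~ (G ** BCut G >> H)) /\
  (exists X Y : formula FA,
     ~ GT4_consequence (fun Z => Z = X \/ Z = Neg X) Y).
Proof.
  destruct FA_nonempty as [p]. split; [| split].
  - exists (GAtom p), (Cut Blank). intros H.
    specialize (H (two_worlds FA)). discriminate H.
  - exists (GAtom p), (Cut Blank). intros H.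
    pose proof (GET4_sound FA (two_worlds FA) _ _ H true eq_refl) as Hfalse.
    discriminate Hfalse.
  - exists (Atom p), (Neg Lam). intros H.
    assert (Hfalse : val (actual (two_worlds FA)) (Neg Lam) = true).
    { apply GT4_sound with (2 := H). now intros X [-> | ->]. }
    discriminate Hfalse.
Qed.
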